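(* Let $\Gamma$ be a finitely generated non-amenable group with sub-rapid decay (SRD). Let $g\in\Gamma$ be a non-central element and let $C=C_\Gamma(g)$ be its centralizer. If $C\cap\gamma C\gamma^{-1}$ grows subexponentially for all $\gamma\in\Gamma\setminus C$, then $g$ acts topologically freely on any compact minimal $\Gamma$-space $\mathcal{X}$ with amenable neighborhood stabilizers.
   Context: Fix a finite symmetric generating set of $\Gamma$ and let $B_n(\Gamma)$ be the ball of radius $n$ around the identity for the word length. Let $\lambda$ be the left regular representation of $\Gamma$ on $\ell^2(\Gamma)$, extended linearly to $\mathbb{C}\Gamma$. Define $$\rho(n)=\max\left\{\frac{\|\lambda(f)\|}{\|f\|_2}: 0\neq f\in\mathbb{C}\Gamma,\ \mathrm{supp}(f)\subseteq B_n(\Gamma)\right\},$$ where $\|\lambda(f)\|$ is the operator norm. $\Gamma$ has sub-rapid decay (SRD) if $\rho(n)$ grows subexponentially, where a function $\phi:\mathbb{N}\to[0,\infty)$ grows subexponentially if $\limsup_n\phi(n)^{1/n}\le 1$. A subset $A\subseteq\Gamma$ grows subexponentially if its growth function $\alpha_A(n)=|A\cap B_n(\Gamma)|$ (computed with the word length of $\Gamma$) grows subexponentially. A compact $\Gamma$-space is a compact Hausdorff space with an action of $\Gamma$ by homeomorphisms; it is minimal if every orbit is dense. The neighborhood stabilizer of $x\in\mathcal{X}$ is $\Gamma_x^o=\{h\in\Gamma: hy=y \text{ for all } y \text{ in some open neighborhood of } x\}$; $\mathcal{X}$ has amenable neighborhood stabilizers if $\Gamma_x^o$ is amenable for all $x\in\mathcal{X}$.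 An element $g$ acts topologically freely on $\mathcal{X}$ if $\mathrm{Fix}(g)=\{x\in\mathcal{X}: gx=x\}$ has empty interior. *)

(* Defs.v *)
From HB Require Import structures.
From mathcomp Require Import all_boot all_order all_algebra finmap.
From mathcomp Require Import complex.
From mathcomp Require Import all_classical all_reals all_analysis.

Set Implicit Arguments.
Unset Strict Implicit.
Unset Printing Implicit Defensive.

Import Order.TTheory GRing.Theory Num.Theory.
Local Open Scope classical_set_scope.
Local Open Scope ring_scope.

Section GroupNotions.
Variable G : groupType.
Implicit Types (S : {fset G}) (g x : G) (A H : set G) (n : nat).

(* Every element is a word in S; since S is closed under inverses this is
   generation as a group. *)
Definition symmetric_generating_set S : Prop :=
  (forall s, s \in S -> (s^-1)%g \in S) /\
  (forall x, exists w : seq G,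
     {subset w <= S} /\ x = (\prod_(s <- w) s)%g).

Definition word_ball S n : set G :=
  [set x | exists w : seq G,
     [/\ (size w <= n)%N, {subset w <= S} & x = (\prod_(s <- w) s)%g]].

Lemma finite_word_ball S n : finite_set (word_ball S n).
Proof.
elim: n => [|n IHn].
  apply: (@sub_finite_set _ _ [set 1%g]); last exact: finite_set1.
  by move=> x [[|s w] [//= _ _ ->]]; rewrite big_nil.
pose T := [set (p.1 * p.2)%g | p in [set` S] `*` word_ball S n].
apply: (@sub_finite_set _ _ ([set 1%g] `|` T)).
  move=> x [[|s w] [/= sw wS ->]]; first by left; rewrite big_nil.
  right; exists (s, (\prod_(t <- w) t)%g); last by rewrite /= big_cons.
  split=> /=; first by apply: wS; rewrite mem_head.
  by exists w; split=> // t tw; apply: wS; rewrite in_cons tw orbT.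
rewrite finite_setU; split; first exact: finite_set1.
by apply: finite_image; apply: finite_setX => //; exact: finite_fset.
Qed.

(* fset_set is meaningful here because balls are finite (finite_word_ball). *)
Definition growth S A n : nat := #|` fset_set (A `&` word_ball S n)|%fset.

Definition centralizer g : set G := [set x | commute x g].

Definition conjugate g A : set G := [set (g * a * g^-1)%g | a in A].

(* von Neumann's definition, for a subgroup H of G (only subsets of H matter):
   a left-invariant finitely additive probability measure on all subsets. *)
Definition amenable (R : realType) H : Prop :=
  exists m : set G -> R,
    [/\ forall A, A `<=` H -> 0 <= m A,
        m H = 1,
        forall A B, A `<=` H -> B `<=` H -> A `&` B = set0 ->
          m (A `|` B) = m A + m B
      & forall h A, H h -> A `<=` H -> m [set (h * a)%g | a in A] = m A].

End GroupNotions.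

Definition grows_subexponentially (R : realType) (phi : nat -> \bar R) : Prop :=
  (limn_esup (fun n => (phi n `^ (n%:R^-1))%E) <= 1)%E.

Section RapidDecay.
Variables (R : realType) (G : groupType).
Implicit Types (xi : G -> R[i]) (f : {fsfun G -> R[i] with 0}).

(* The norm of l^2(G), extended by +oo to functions outside l^2(G). *)
Definition l2norm xi : \bar R :=
  sqrte (\esum_(x in [set: G]) ((Normc.normc (xi x)) ^+ 2)%:E).

Definition left_regular (s : G) xi : G -> R[i] := fun x => xi (s^-1 * x)%g.

(* Elements of the complex group algebra are the finitely supported functions
   f; left_regular is extended linearly to them. *)
Definition left_regular_alg f xi : G -> R[i] :=
  fun x => \sum_(s <- finsupp f) f s * left_regular s xi x.

Definition l2_operator_norm (T : (G -> R[i]) -> (G -> R[i])) : \bar R :=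
  ereal_sup [set l2norm (T xi) | xi in [set xi | (l2norm xi <= 1)%E]].

(* The supremum is a maximum, as the unit sphere of the functions supported in
   a (finite) ball is compact. *)
Definition rho (S : {fset G}) (n : nat) : \bar R :=
  ereal_sup [set (l2_operator_norm (left_regular_alg f) / l2norm f)%E
            | f in [set f : {fsfun G -> R[i] with 0} |
                    finsupp f != fset0 /\ [set` finsupp f] `<=` word_ball S n]].

Definition sub_rapid_decay (S : {fset G}) : Prop :=
  grows_subexponentially (rho S).

End RapidDecay.

Definition subset_grows_subexponentially (R : realType) (G : groupType)
    (S : {fset G}) (A : set G) : Prop :=
  @grows_subexponentially R (fun n => ((growth S A n)%:R)%:E).

Section Dynamics.
Variables (G : groupType) (X : topologicalType) (act : G -> X -> X).

Definition compact_Gspace : Prop :=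
  [/\ compact [set: X],
      hausdorff_space X,
      forall x, act 1%g x = x,
      forall g h x, act (g * h)%g x = act g (act h x)
    & forall g, continuous (act g)].

Definition minimal_Gspace : Prop :=
  forall x, dense [set act g x | g in [set: G]].

Definition neighborhood_stabilizer (x : X) : set G :=
  [set h | exists U : set X, open_nbhs x U /\ forall y, U y -> act h y = y].

Definition amenable_neighborhood_stabilizers (R : realType) : Prop :=
  forall x, amenable R (neighborhood_stabilizer x).

Definition fixed_points (g : G) : set X := [set x | act g x = x].

Definition acts_topologically_freely (g : G) : Prop :=
  interior (fixed_points g) = set0.

End Dynamics.

(* Main.v *)
Require Import Defs.
From HB Require Import structures.
From mathcomp Require Import all_boot all_order all_algebra finmap.
From mathcomp Require Import complex.
From mathcomp Require Import all_classical all_reals all_analysis.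
From mathcomp Require Import ring lra zify.

(** Suppose that [g] fixes every point of a nonempty open set [U], and let [C]
    be the centralizer of [g]. If [t * s] maps a point of [U] to [x], then
    [t * s * g * (t * s)^-1] lies in the neighborhood stabilizer [H] of [x],
    which is amenable. Rapid decay limits how often this can happen.

    Let [A] be a subgroup, [T] its part in the ball of radius [n], and [f] the
    image of the counting measure on [T] under [t -> t * (s * g * s^-1) * t^-1].
    Since [H] is amenable, almost invariant finite sets show that the norm of
    [lambda(f)] is at least half the mass that [f] gives to [H]
    ([amenable_mass_le_norm]). On the other hand, rapid decay bounds this norm
    by a subexponential factor times the l2-norm of [f]; and as two elements
    of [T] give the same conjugate exactly when they differ by an element of
    [s * C * s^-1], the square of the l2-norm is at most [#|T|] times the growth
    of the intersection of [A] and [s * C * s^-1] at radius [2 * n]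
    ([rapid_decay_count]). If finitely many translates [s * U] cover the space,
    every [t] in [T] is counted for one of these [s], so that [A] grows
    subexponentially as soon as all these intersections do ([covering_growth]).

    If the translates [s * U] with [s] outside [C] cover the space, apply this
    to [A = C], where the intersections are subexponential by hypothesis, and
    then to [A = Gamma], where they are conjugates of [C]. Otherwise some point
    [z] can be moved into [U] by elements of [C] only; by minimality and
    compactness [C] then has finite index, and so does its intersection with
    any of its conjugates ([finite_index_growth]). In both cases [Gamma] grows
    subexponentially, hence is amenable ([subexponential_amenable]), which is
    excluded.

    The passage from an invariant mean to almost invariant finite sets
    ([mean_folner]) is combinatorial: if all finite sets [F] expanded by a
    fixed factor under some finite [K], the infinite marriage theorem
    ([hall_marriage]) would give a two-to-one map of bounded displacement, and
    hence a paradoxical decomposition. *)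

Set Implicit Arguments.
Unset Strict Implicit.
Unset Printing Implicit Defensive.

Import Order.TTheory GRing.Theory Num.Theory.
Import numFieldNormedType.Exports.
Local Open Scope classical_set_scope.
Local Open Scope ring_scope.

(** * The marriage theorem for infinite families of finite sets *)

Section Marriage.
Variables I T : choiceType.
Implicit Types (A : I -> {fset T}) (J : {fset I}).

Definition hall_condition A : Prop :=
  forall J, (#|` J| <= #|` \bigcup_(i <- J) A i|)%fset%N.

Lemma bigfcup_sub A A' J : (forall i, i \in J -> A i `<=` A' i)%fset ->
  (\bigcup_(i <- J) A i `<=` \bigcup_(i <- J) A' i)%fset.
Proof.
move=> sAA'; apply/bigfcupsP => i iJ _.
by apply: fsubset_trans (sAA' _ iJ) _; apply: bigfcup_sup.
Qed.

(** Finitely many members of a chain have a least one, so the pointwise infimum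
    of a chain is reached on any finite set of indices by a single member. *)
Lemma chain_selection A (C : set (I -> {fset T})) J : C A ->
  (forall B B', C B -> C B' ->
     (forall i, B i `<=` B' i)%fset \/ (forall i, B' i `<=` B i)%fset) ->
  forall D : I -> I -> {fset T}, (forall i, C (D i)) ->
  exists2 B, C B & forall i, i \in J -> (B i `<=` D i i)%fset.
Proof.
move=> CA totC D CD.
suff [B CB HB] : exists2 B, C B & forall i, i \in enum_fset J -> (B i `<=` D i i)%fset.
  by exists B.
elim: (enum_fset J) => [|j s [B CB HB]]; first by exists A.
have [BD|DB] := totC _ _ CB (CD j).
  exists B => // i; rewrite inE => /orP[/eqP->|]; [exact: BD|exact: HB].
exists (D j) => // i; rewrite inE => /orP[/eqP->//|/HB].
exact: fsubset_trans (DB i).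
Qed.

(** Zorn's lemma applies because the condition only involves finitely many
    indices at a time, and on these the infimum of a chain of families of finite
    sets is one of its members. *)
Lemma minimal_hall_family A0 : hall_condition A0 ->
  exists A, [/\ hall_condition A, (forall i, A i `<=` A0 i)%fset &
    forall B, hall_condition B -> (forall i, B i `<=` A i)%fset ->
      forall i, (A i `<=` B i)%fset].
Proof.
move=> hA0.
pose P A := hall_condition A /\ (forall i, A i `<=` A0 i)%fset.
have PA0 : P A0 by split.
pose R (s t : {A | P A}) := `[< forall i, (sval t i `<=` sval s i)%fset >].
have [||C totC|[A [hA AA0]] minA] := @ZL_preorder _ (exist _ A0 PA0) R.
- by move=> s; apply/asboolP.
- move=> r s t /asboolP rs /asboolP st; apply/asboolP => i.
  exact: fsubset_trans (st i) (rs i).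
- have [[c0 Cc0]|C0] := pselect (exists c, C c); last first.
    by exists (exist _ A0 PA0) => s Cs; case: C0; exists s.
  pose C' := [set sval c | c in C].
  have totC' B B' : C' B -> C' B' ->
      (forall i, B i `<=` B' i)%fset \/ (forall i, B' i `<=` B i)%fset.
    move=> [b Cb <-] [b' Cb' <-].
    by case: (totC _ _ Cb Cb') => /asboolP; [right|left].
  (* the member of the chain with the fewest elements at i is least at i *)
  have least i : exists D, C' D /\ forall B, C' B -> (D i `<=` B i)%fset.
    have exn : exists n, `[< exists2 B, C' B & #|` B i|%fset = n >].
      by exists #|` sval c0 i|%fset; apply/asboolP; exists (sval c0) => //; exists c0.
    case: (ex_minnP exn) => n /asboolP[D CD Dn] minn; exists D; split=> // B CB.
    have [/(_ i)//|/(_ i) BD] := totC' _ _ CD CB.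
    suff -> : D i = B i by [].
    apply/eqP; rewrite eq_sym eqEfcard BD /= Dn; apply: minn.
    by apply/asboolP; exists B.
  have [D HD] := choice least.
  have PD : P (fun i => D i i).
    split=> [J|i]; last first.
      have [[b Cb <-] _] := HD i; case: b Cb => b [_ hb] /= _; exact: hb.
    have [|B [b Cb Bb] HB] := @chain_selection (sval c0) C' J _ totC' D (fun i => (HD i).1).
      by exists c0.
    apply: leq_trans (fsubset_leq_card (bigfcup_sub HB)).
    by rewrite -Bb; case: b {Cb Bb} => b [].
  exists (exist _ _ PD) => s Cs; apply/asboolP => i /=.
  by apply: (HD i).2; exists s.
- exists A; split=> // B hB BA.
  have PB : P B by split=> // i; exact: fsubset_trans (BA i) (AA0 i).
  have /minA/asboolP// : R (exist _ A (conj hA AA0)) (exist _ B PB).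
  exact/asboolP.
Qed.

(** This is Rado's argument. If both removals failed, there would be [J] and [K],
    not containing [i], such that [A i `\ x] together with the sets indexed by
    [J] has at most [#|J|] elements, and likewise for [y] and [K]. As [x != y], the
    union of these two finite sets contains [A i] and all sets indexed by [J] or
    [K], while their intersection contains those indexed by both; counting
    contradicts the condition for [A] at [i |` (J `|` K)] and at [J `&` K]. *)
Lemma hall_remove A i x y : hall_condition A ->
  x \in A i -> y \in A i -> x != y ->
  exists2 z, z \in [fset x; y]%fset &
    hall_condition (fun j => if j == i then (A i `\ z)%fset else A j).
Proof.
move=> hA Ax Ay xy; apply: contrapT => no.
pose rm z j := if j == i then (A i `\ z)%fset else A j.
have rm_sub z j : (rm z j `<=` A j)%fset.
  by rewrite /rm; case: eqP => [->|//]; exact: fsubD1set.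
have obstruction z : z \in [fset x; y]%fset -> exists J : {fset I},
    i \notin J /\ (#|` (A i `\ z) `|` \bigcup_(j <- J) A j| <= #|` J|)%fset%N.
  move=> zxy; have /existsNP[J /negP] : ~ hall_condition (rm z).
    by move=> h; apply: no; exists z.
  rewrite -ltnNge => ltJ.
  have iJ : i \in J.
    apply: contraLR ltJ => iJ; rewrite -leqNgt; apply: leq_trans (hA J) _.
    apply: fsubset_leq_card; apply/bigfcupsP => j jJ _.
    apply: fsubset_trans (bigfcup_sup _ jJ isT).
    by rewrite /rm; case: eqP => // ji; rewrite -ji jJ in iJ.
  exists (J `\ i)%fset; split; first by rewrite !inE eqxx.
  rewrite -ltnS; apply: leq_trans (_ : (#|` J| <= _)%N); last first.
    by rewrite (cardfsD1 i J) iJ.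
  apply: leq_ltn_trans ltJ; apply: fsubset_leq_card.
  rewrite fsubUset; apply/andP; split.
    by apply: fsubset_trans (bigfcup_sup _ iJ isT); rewrite /rm eqxx.
  apply/bigfcupsP => j; rewrite !inE => /andP[ji jJ] _.
  apply: fsubset_trans (bigfcup_sup _ jJ isT).
  by rewrite /rm (negbTE ji).
have [J [iJ cJ]] := obstruction x (fset21 _ _).
have [K [iK cK]] := obstruction y (fset22 _ _).
set AJ := (_ `|` _)%fset in cJ; set AK := (_ `|` _)%fset in cK.
have : (#|` i |` (J `|` K)| + #|` J `&` K| <= #|` AJ| + #|` AK|)%fset%N.
  rewrite -(cardfsUI AJ); apply: leq_add.
    apply: leq_trans (hA _) _; apply: fsubset_leq_card.
    apply/bigfcupsP => j; rewrite !inE => /orP[/eqP->|/orP[jJ|jK]] _;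
        apply/fsubsetP => z zA; rewrite !inE.
    - rewrite zA !andbT; case: (eqVneq z x) => [->|//].
      by rewrite xy !orbT.
    - suff -> : z \in (\bigcup_(j <- J) A j)%fset by rewrite orbT.
      by apply/bigfcupP; exists j; rewrite ?jJ.
    - suff -> : z \in (\bigcup_(j <- K) A j)%fset by rewrite !orbT.
      by apply/bigfcupP; exists j; rewrite ?jK.
  apply: leq_trans (hA _) _; apply: fsubset_leq_card.
  apply/bigfcupsP => j; rewrite !inE => /andP[jJ jK] _.
  apply/fsubsetP => z zA; rewrite !inE.
  have -> : z \in (\bigcup_(j <- J) A j)%fset by apply/bigfcupP; exists j; rewrite ?jJ.
  have -> : z \in (\bigcup_(j <- K) A j)%fset by apply/bigfcupP; exists j; rewrite ?jK.
  by rewrite !orbT.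
rewrite cardfsU1 !inE (negbTE iJ) (negbTE iK) /= -addnA cardfsUI.
by move=> /leq_trans/(_ (leq_add cJ cK)); rewrite add1n ltnn.
Qed.

(** A minimal family satisfying the condition consists of singletons, since an
    element could be removed from any larger set. *)
Lemma hall_marriage A : hall_condition A ->
  exists alpha : I -> T, injective alpha /\ forall i, alpha i \in A i.
Proof.
move=> /minimal_hall_family[B [hB BA minB]].
have B1 i : #|` B i|%fset = 1%N.
  apply/eqP; rewrite eqn_leq; apply/andP; split; last first.
    by have := hB [fset i]%fset; rewrite cardfs1 big_seq_fset1.
  rewrite leqNgt; apply/negP => B2.
  have /fset0Pn[x xB] : B i != fset0 by rewrite -cardfs_gt0 (ltn_trans _ B2).
  have /fset0Pn[y] : (B i `\ x)%fset != fset0.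
    by rewrite -cardfs_gt0; rewrite (cardfsD1 x) xB in B2.
  rewrite !inE => /andP[yx yB].
  have [|z zxy hrm] := hall_remove hB xB yB; first by rewrite eq_sym.
  have zB : z \in B i by move: zxy; rewrite !inE => /orP[]/eqP->.
  have /(minB _ hrm)/(_ i) : forall j,
      ((if j == i then (B i `\ z)%fset else B j) `<=` B j)%fset.
    by move=> j; case: eqP => [->|//]; exact: fsubD1set.
  by rewrite eqxx => /fsubsetP/(_ z zB); rewrite !inE eqxx.
have /choice[alpha Balpha] i : exists x, B i = [fset x]%fset.
  by apply/cardfs1P/eqP.
exists alpha; split=> [i j aij|i]; last first.
  by apply: (fsubsetP (BA i)); rewrite Balpha inE.
apply/eqP; apply: contraT => ij.
have := hB [fset i; j]%fset; rewrite cardfs2 ij /= leqNgt; apply: contraNT => _.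
apply: (@leq_ltn_trans #|` [fset alpha i]|%fset); last by rewrite cardfs1.
apply: fsubset_leq_card; apply/bigfcupsP => k; rewrite !inE => /orP[]/eqP-> _.
  by rewrite Balpha.
by rewrite Balpha aij.
Qed.

End Marriage.

(** * From invariant means to almost invariant finite sets *)

Section MeanImpliesFolner.
Variables (R : realType) (G : groupType) (H : set G).
Implicit Types (K F : {fset G}).

Definition translates K F : {fset G} :=
  (\bigcup_(k <- K) [fset (k * x)%g | x in F])%fset.

Lemma translatesP K F y :
  reflect (exists k x, [/\ k \in K, x \in F & y = (k * x)%g])
          (y \in translates K F).
Proof.
apply: (iffP (bigfcupP _ _ _ _)) => [[k]|[k [x [kK xF ->]]]].
  by rewrite andbT => kK /imfsetP[x xF ->]; exists k, x.
by exists k; rewrite ?kK//; apply/imfsetP; exists x.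
Qed.

Lemma mean_bigcup (m : set G -> R) (I : eqType) (r : seq I) (B : I -> set G) :
  (forall A A', A `<=` H -> A' `<=` H -> A `&` A' = set0 ->
     m (A `|` A') = m A + m A') ->
  uniq r -> (forall i, B i `<=` H) ->
  (forall i j x, B i x -> B j x -> i = j) ->
  m [set x | exists2 i, i \in r & B i x] = \sum_(i <- r) m (B i).
Proof.
move=> addm + BH disjB; elim: r => [_|i r IHr /= /andP[ir ur]].
  rewrite big_nil (_ : [set x | _] = set0); last first.
    by apply/seteqP; split=> // x [].
  by have := addm set0 set0; rewrite setU0 setI0 => /(_ _ _ _)/eqP;
    rewrite -subr_eq0 opprD addNKr oppr_eq0 => /(_ _ _ _)/eqP->.
rewrite big_cons -IHr// -addm //.
- congr m; apply/seteqP; split=> x /=.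
    move=> [j]; rewrite inE => /orP[/eqP->|jr] Bj; first by left.
    by right; exists j.
  by move=> [Bx|[j jr Bx]]; [exists i|exists j]; rewrite ?mem_head// inE jr orbT.
- by move=> x [j _ /BH].
- apply/seteqP; split=> // x [Bix [j jr Bjx]].
  by rewrite (disjB _ _ _ Bix Bjx) jr in ir.
Qed.

(** Sort [H] into the finitely many pieces on which [x -> alpha (x, b)] is
    translation by a given [k]. For each [b] the translated pieces are disjoint
    of total mass [m H = 1], and those for the two values of [b] are disjoint, so
    that [H] would have mass at least [2]. *)
Lemma no_doubling (L : {fset G}) (alpha : G * bool -> G) :
  amenable R H -> (forall h k, H h -> H k -> H (h * k)%g) ->
  (forall k, k \in L -> H k) ->
  injective alpha ->
  (forall x b, exists2 k, k \in L & alpha (x, b) = (k * x)%g) -> False.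
Proof.
move=> [m [m_ge0 mH addm minv]] HM LH inj_alpha alphaL.
pose B b k := [set x | H x /\ alpha (x, b) = (k * x)%g].
pose kB b k : set G := if k \in L then [set (k * x)%g | x in B b k] else set0.
pose U b := [set y | exists2 k, k \in enum_fset L & kB b k y].
have kBH b k : kB b k `<=` H.
  rewrite /kB; case: ifP => [kL _ [x [Hx _] <-]|_ _ []].
  by apply: HM; [exact: LH|].
have UH b : U b `<=` H by move=> y [k _ /kBH].
have kBP b k y : kB b k y -> exists x, alpha (x, b) = y /\ y = (k * x)%g.
  by rewrite /kB; case: ifP => [_ [x [_ Hx] <-]|_ []]; exists x.
have mU b : m (U b) = 1.
  rewrite (mean_bigcup addm (fset_uniq L) (kBH b)); last first.
    move=> k k' y /kBP[x [ax xy]] /kBP[x' [ax' x'y]].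
    have [xx'] := inj_alpha _ _ (etrans ax (esym ax')).
    by move: x'y; rewrite xy xx' => /mulIg.
  rewrite -mH (_ : H = [set x | exists2 k, k \in enum_fset L & B b k x]).
    rewrite (mean_bigcup addm (fset_uniq L)).
    - rewrite big_seq_cond [RHS]big_seq_cond; apply: eq_bigr => k.
      rewrite andbT => kL; rewrite /kB ifT// minv//; last by move=> x [].
      exact: LH.
    - by move=> k x [].
    - by move=> k k' x [_ axk] [_]; rewrite axk => /mulIg.
  apply/seteqP; split=> x /=; last by move=> [k _ []].
  by move=> Hx; have [k kL ak] := alphaL x b; exists k.
have : m (U true `|` U false) = 1 + 1.
  rewrite addm// ?mU//; apply/seteqP; split=> // y [[k _ /kBP[x [ax _]]]].
  by move=> [k' _ /kBP[x' [ax' _]]]; have [] := inj_alpha _ _ (etrans ax (esym ax')).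
have UUH : U true `|` U false `<=` H by move=> x [/UH|/UH].
have DH : H `\` (U true `|` U false) `<=` H by move=> x [].
have := addm _ _ UUH DH; rewrite setDE setIA setIAC setICr set0I => /(_ erefl).
rewrite -setDE setDUK// mH => mUD mUU; have := m_ge0 _ DH.
by move: mUD; rewrite mUU; lra.
Qed.

(** Otherwise [translates K] would multiply cardinals by at least [3 / 2], its
    second iterate by at least [9 / 4 >= 2], and the marriage theorem would
    provide the map excluded by [no_doubling]. *)
Lemma mean_folner K : amenable R H ->
  (forall h k, H h -> H k -> H (h * k)%g) -> (forall k, k \in K -> H k) ->
  exists2 F : {fset G}, F != fset0 &
    (2 * #|` translates K F| <= 3 * #|` F|)%fset%N.
Proof.
move=> amH HM KH; apply: contrapT => noF.
have expand F : (3 * #|` F| <= 2 * #|` translates K F|)%fset%N.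
  have [->|F0] := eqVneq F fset0; first by rewrite cardfs0.
  by rewrite ltnW// ltnNge; apply/negP => ?; apply: noF; exists F.
have double F : (2 * #|` F| <= #|` translates K (translates K F)|)%fset%N.
  by have := expand F; have := expand (translates K F); lia.
have [|alpha [inj_alpha alphaA]] := @hall_marriage _ _
    (fun i : G * bool => translates K (translates K [fset i.1]%fset)).
  move=> J; pose F := [fset i.1 | i in J]%fset.
  apply: leq_trans (leq_trans (double F) _); last first.
    apply/fsubset_leq_card/fsubsetP => y.
    move=> /translatesP[k [z [kK /translatesP[k' [x [k'K xF ->]]] ->]]].
    move: xF => /imfsetP[i iJ ->]; apply/bigfcupP; exists i; first by rewrite iJ.
    apply/translatesP; exists k, (k' * i.1)%g; split=> //.
    by apply/translatesP; exists k', i.1; rewrite inE.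
  have : (J `<=` [fset (x, true) | x in F] `|` [fset (x, false) | x in F])%fset.
    apply/fsubsetP => -[x b] xJ.
    have xF : x \in F by apply/imfsetP; exists (x, b).
    by rewrite inE; apply/orP; case: b xJ => _; [left|right]; apply/imfsetP; exists x.
  move=> /fsubset_leq_card/leq_trans; apply.
  by rewrite cardfsU mul2n -addnn (leq_trans (leq_subr _ _))// leq_add// leq_imfset_card.
apply: (@no_doubling (translates K K) alpha) => // [k /translatesP[x [y [xK yK ->]]]|x b].
  by apply: HM; exact: KH.
have /translatesP[k [z [kK /translatesP[k' [w [k'K + ->]]]]]] := alphaA (x, b).
rewrite inE => /eqP-> /= ->; exists (k * k')%g; last by rewrite mulgA.
by apply/translatesP; exists k, k'.
Qed.

End MeanImpliesFolner.

(** * Operator norms and amenable subgroups *)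

Section OperatorNorm.
Variables (R : realType) (G : groupType).
Implicit Types (xi : G -> R[i]) (F : {fset G}) (f : {fsfun G -> R[i] with 0}).

Lemma le_l2norm xi F :
  ((Num.sqrt (\sum_(x <- F) Normc.normc (xi x) ^+ 2))%:E <= l2norm xi)%E.
Proof.
rewrite /l2norm -[leLHS]/(sqrte (_%:E)) lee_sqrt; last first.
  by apply: esum_ge0 => x _; rewrite lee_fin sqr_ge0.
apply: esum_ge; exists [set` F]; first by split=> //; exact: finite_fset.
by rewrite -fsbig_seq ?fset_uniq// sumEFin.
Qed.

Lemma l2norm_finite_support xi F : (forall x, x \notin F -> xi x = 0) ->
  l2norm xi = (Num.sqrt (\sum_(x <- F) Normc.normc (xi x) ^+ 2))%:E.
Proof.
move=> xi0; rewrite /l2norm -[RHS]/(sqrte (_%:E)); congr sqrte.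
transitivity (\esum_(x in [set` F]) (Normc.normc (xi x) ^+ 2)%:E).
  rewrite [RHS]esum_mkcond; apply: eq_esum => x _; case: ifPn => // xF.
  rewrite xi0 ?Normc.normc0 ?expr0n//.
  by apply: contra xF => ?; apply/mem_set.
rewrite esum_fset; [|exact: finite_fset|by move=> x _; rewrite lee_fin sqr_ge0].
by rewrite -fsbig_seq ?fset_uniq// sumEFin.
Qed.

Lemma normc_real (r : R) : 0 <= r -> Normc.normc (real_complex R r) = r.
Proof. by move=> r0; rewrite /= expr0n addr0 sqrtr_sqr ger0_norm. Qed.

(** Both [F] and its translate by [s] lie in [translates K F], of cardinal at most
    [3 / 2 * #|F|]. *)
Lemma folner_overlap (K F : {fset G}) s : s \in K -> 1%g \in K ->
  (2 * #|` translates K F| <= 3 * #|` F|)%fset%N ->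
  (#|` F| <= 2 * #|` [fset x in F | (s^-1 * x)%g \in F]|)%fset%N.
Proof.
move=> sK K1 KF; pose sF := [fset (s * x)%g | x in F]%fset.
have csF : #|` sF|%fset = #|` F|%fset by rewrite card_imfset//=; exact: mulgI.
have -> : [fset x in F | (s^-1 * x)%g \in F]%fset = (F `&` sF)%fset.
  apply/fsetP => x; rewrite !inE; congr andb.
  apply/idP/imfsetP => [sx|[y yF ->]]; last by rewrite mulKg.
  by exists (s^-1 * x)%g => //; rewrite mulVKg.
have /fsubset_leq_card : (F `|` sF `<=` translates K F)%fset.
  rewrite fsubUset; apply/andP; split; apply/fsubsetP => x.
    by move=> xF; apply/translatesP; exists 1%g, x; rewrite mul1g.
  by move=> /imfsetP[y yF ->]; apply/translatesP; exists s, y.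
by have := cardfsUI F sF; move: KF; rewrite csF; lia.
Qed.

(** The test vector is the normalized indicator of a finite set [F] that is almost
    invariant under the part of the support of [f] lying in [H]: each such [s]
    moves at least half of [F] into [F]. Since [f] is nonnegative, the other
    elements of its support can only help. *)
Lemma amenable_mass_le_norm (H : set G) f (a : G -> R) :
  amenable R H -> H 1%g -> (forall h k, H h -> H k -> H (h * k)%g) ->
  (forall s, 0 <= a s) -> (forall s, f s = real_complex R (a s)) ->
  (((\sum_(s <- finsupp f | s \in H) a s) / 2)%:E
     <= l2_operator_norm (left_regular_alg f))%E.
Proof.
move=> amH H1 HM a0 fa.
pose K := (1%g |` [fset s in finsupp f | s \in H])%fset.
have [k|F F0 KF] := mean_folner (K := K) amH HM.
  by rewrite !inE => /orP[/eqP->//|/andP[_]]; rewrite inE.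
have F_gt0 : 0 < (#|` F|%fset)%:R :> R by rewrite ltr0n cardfs_gt0.
pose c : R := (Num.sqrt (#|` F|%fset)%:R)^-1.
have c2 : c ^+ 2 * (#|` F|%fset)%:R = 1.
  by rewrite exprVn sqr_sqrtr ?ltW// mulVf ?gt_eqF.
(* c * N is the image of xi under the convolution operator *)
pose N x : R := \sum_(s <- finsupp f) a s * ((s^-1 * x)%g \in F)%:R.
have N_ge0 x : 0 <= N x by apply: sumr_ge0 => s _; rewrite mulr_ge0.
have c_ge0 : 0 <= c by rewrite invr_ge0 sqrtr_ge0.
pose xi x := real_complex R (c * (x \in F)%:R).
have xi1 : l2norm xi = 1%E.
  rewrite (@l2norm_finite_support _ F); last first.
    by move=> x /negbTE xF; rewrite /xi xF mulr0 rmorph0.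
  congr (_%:E); rewrite -[RHS]sqrtr1; congr Num.sqrt.
  rewrite -[RHS]c2 card_fset_sum1 natr_sum mulr_sumr big_seq [RHS]big_seq.
  by apply: eq_bigr => x xF; rewrite normc_real /xi xF ?mulr1 ?mulr1.
have fxi x : left_regular_alg f xi x = real_complex R (c * N x).
  rewrite /left_regular_alg /N mulr_sumr rmorph_sum; apply: eq_bigr => s _.
  by rewrite fa /left_regular /xi -rmorphM mulrCA.
set mu := _ / 2.
have mu_ge0 : 0 <= mu by rewrite divr_ge0// sumr_ge0.
have sumN : mu * (#|` F|%fset)%:R <= \sum_(x <- F) N x.
  rewrite /N exchange_big/= /mu mulrAC mulr_suml mulr_suml big_mkcond/=.
  rewrite big_seq [leRHS]big_seq; apply: ler_sum => s sf.
  rewrite -mulr_sumr; case: ifPn => sH; last first.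
    by rewrite mulr_ge0// sumr_ge0// => x _; rewrite ler0n.
  rewrite -mulrA ler_wpM2l// ler_pdivrMr// -natr_sum -natrM ler_nat mulnC.
  rewrite (_ : (\sum_(x <- F) _)%N = #|` [fset x in F | (s^-1 * x)%g \in F]|%fset).
    apply: (@folner_overlap K) => //; last by rewrite !inE eqxx.
    by rewrite !inE/= sf sH orbT.
  rewrite card_fset_sum1 big_fset/= [RHS]big_mkcond/=.
  by apply: eq_bigr => x _; case: ifP.
apply: (@le_trans _ _ (l2norm (left_regular_alg f xi))); last first.
  by apply: ereal_sup_ubound; exists xi => //=; rewrite xi1.
apply: le_trans (le_l2norm _ F); rewrite lee_fin.
rewrite -[leLHS]ger0_norm// -sqrtr_sqr ler_sqrt; last first.
  by apply: sumr_ge0 => x _; exact: sqr_ge0.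
under eq_bigr do rewrite fxi normc_real ?mulr_ge0// exprMn.
rewrite -mulr_sumr -[leLHS]mul1r -c2 -mulrA ler_wpM2l ?sqr_ge0//.
(* the variance of N about mu is nonnegative, which replaces Cauchy-Schwarz *)
have : 0 <= \sum_(x <- F) (N x - mu) ^+ 2 by apply: sumr_ge0 => x _; exact: sqr_ge0.
have -> : \sum_(x <- F) (N x - mu) ^+ 2 =
    \sum_(x <- F) N x ^+ 2 + (- 2 * mu) * \sum_(x <- F) N x +
    mu ^+ 2 * (#|` F|%fset)%:R.
  rewrite card_fset_sum1 natr_sum !mulr_sumr -!big_split/=.
  by apply: eq_bigr => x _; ring.
have := ler_wpM2l mu_ge0 sumN; lra.
Qed.

End OperatorNorm.

(** * Subexponential growth *)

Section Subexponential.
Variable R : realType.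
Implicit Types (phi : nat -> \bar R) (psi : nat -> nat) (r : R).

Lemma grows_subexponentially_le phi r : grows_subexponentially phi -> 1 < r ->
  exists N, forall n, (N <= n)%N -> (phi n <= (r ^+ n)%:E)%E.
Proof.
move=> phi_sub r1; have r_gt0 : 0 < r by rewrite (lt_trans _ r1).
have /ereal_inf_lt[_ [A [N _ NA] <-] supA] := le_lt_trans phi_sub (r1 : 1%:E < r%:E)%E.
exists N.+1 => n Nn.
have n_neq0 : n%:R != 0 :> R by rewrite pnatr_eq0; case: n Nn.
have : (phi n `^ n%:R^-1 <= r%:E)%E.
  apply: le_trans (ltW supA); apply: ereal_sup_ubound; exists n => //.
  by apply: NA => /=; exact: ltnW.
case: (phi n) => [x| |]; last by rewrite leNye.
  rewrite poweR_EFin !lee_fin => xr.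
  have [x0|x0] := leP x 0; first by rewrite (le_trans x0)// exprn_ge0// ltW.
  have -> : x = (x `^ n%:R^-1) ^+ n.
    by rewrite -powR_mulrn ?powR_ge0// -powRrM mulVf// powRr1// ltW.
  by apply: lerXn2r => //; rewrite nnegrE ?powR_ge0// ltW.
by rewrite /= invr_eq0 (negbTE n_neq0).
Qed.

(** This form has a bound at every [n], not only at large ones, and it is
    stable under the changes of variable [n -> a * n + b] that occur below. *)
Definition subexponential psi : Prop :=
  forall r, 1 < r -> exists c, forall n, (psi n)%:R <= c * r ^+ n.

Lemma subexponential_of_grows psi :
  grows_subexponentially (fun n => (psi n)%:R%:E : \bar R) -> subexponential psi.
Proof.
move=> sub r r1; have [N HN] := grows_subexponentially_le sub r1.
have r_ge1 n : 1 <= r ^+ n by rewrite exprn_ege1// ltW.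
exists (1 + \sum_(i < N) (psi i)%:R) => n.
have c0 : 0 <= \sum_(i < N) (psi i)%:R :> R by apply: sumr_ge0.
have [nN|Nn] := ltnP n N; last first.
  have := HN _ Nn; rewrite lee_fin => /le_trans; apply.
  by rewrite ler_peMl ?lerDl// (le_trans _ (r_ge1 n)).
apply: (@le_trans _ _ (1 + \sum_(i < N) (psi i)%:R)); last first.
  by rewrite ler_peMr// addr_ge0.
rewrite (bigD1 (Ordinal nN))//= addrCA lerDl addr_ge0//.
by apply: sumr_ge0.
Qed.

Lemma root_gt1 r k : 1 < r -> exists2 q : R, 1 < q & q ^+ k.+1 = r.
Proof.
move=> r1; have r0 : 0 <= r by rewrite ltW// (lt_trans _ r1).
have qr : (r `^ k.+1%:R^-1) ^+ k.+1 = r.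
  by rewrite -powR_mulrn ?powR_ge0// -powRrM mulVf ?powRr1// pnatr_eq0.
exists (r `^ k.+1%:R^-1) => //; rewrite ltNge; apply/negP => q1.
by have := exprn_ile1 k.+1 (powR_ge0 _ _) q1; rewrite qr leNgt r1.
Qed.

Lemma bernoulli q n : 1 <= q -> 1 + n%:R * (q - 1) <= q ^+ n :> R.
Proof.
move=> q1; elim: n => [|n IHn]; first by rewrite mul0r addr0 expr0.
rewrite exprS -natr1.
have n0 : 0 <= n%:R :> R by [].
have : 0 <= q * (q ^+ n - (1 + n%:R * (q - 1))) by rewrite mulr_ge0 ?subr_ge0//; lra.
have : 0 <= n%:R * (q - 1) * (q - 1) by rewrite !mulr_ge0// subr_ge0.
nra.
Qed.

(** A sequence that grows by a factor at least [r > 1] at each step beats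
    [c * sqrt r ^+ n]. *)
Lemma subexponential_slow_step psi r : subexponential psi -> (0 < psi 0)%N ->
  1 < r -> exists n, (psi n.+1)%:R <= r * (psi n)%:R.
Proof.
move=> sub psi0 r1; apply: contrapT => fast.
have grow n : r ^+ n <= (psi n)%:R.
  elim: n => [|n IHn]; first by rewrite expr0 ler1n.
  rewrite leNgt; apply/negP => lt; apply: fast; exists n.
  rewrite (le_trans (ltW lt))// exprS ler_wpM2l//.
  by rewrite ltW// (lt_trans _ r1).
have [q q1 qr] := root_gt1 1 r1; have [c Hc] := sub q q1.
have q_gt0 : 0 < q by rewrite (lt_trans _ q1).
have qc n : q ^+ n <= c.
  rewrite -(ler_pM2r (exprn_gt0 n q_gt0)); apply: le_trans (Hc n).
  by rewrite -expr2 -exprM mulnC exprM qr.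
have := archi_boundP (_ : 0 <= c / (q - 1)).
have c0 : 0 <= c by rewrite (le_trans _ (qc 0%N)).
have q10 : 0 < q - 1 by rewrite subr_gt0.
move=> /(_ (divr_ge0 c0 (ltW q10))); rewrite ltr_pdivrMr//.
set n := Num.bound _; have := bernoulli n (ltW q1); have := qc n; lra.
Qed.

End Subexponential.

(** A cluster point, which exists by compactness, is a limit along an
    ultrafilter. *)
Lemma ultra_cvg_bounded (R : realType) (U : set_system nat) (u : nat -> R) :
  UltraFilter U -> (forall n, 0 <= u n <= 1) -> exists l : R, u n @[n --> U] --> l.
Proof.
move=> UU u01.
have : (u @ U) `[0, 1]%classic.
  apply: (@filterS _ U _ setT); last exact: filterT.
  by move=> n _ /=; rewrite in_itv/=; exact: u01.
move=> /(@segment_compact R 0 1 (u @ U) _)[p [_ clp]]; exists p => V Vp.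
have [//|nV] := in_ultra_setVsetC (u @^-1` V) UU.
by have [x []] := clp (~` V) V nV Vp.
Qed.

(** * Word balls, and amenability of groups of subexponential growth *)

Section WordBalls.
Variables (G : groupType) (S : {fset G}).
Hypothesis hS : symmetric_generating_set S.
Implicit Types (A B : set G) (x y : G).

Lemma leq_card_inj A B (f : G -> G) : finite_set A -> finite_set B ->
  (forall x, A x -> B (f x)) -> (forall x y, A x -> A y -> f x = f y -> x = y) ->
  (#|` fset_set A| <= #|` fset_set B|)%fset%N.
Proof.
move=> finA finB fAB finj.
have <- : #|` [fset f x | x in fset_set A]|%fset = #|` fset_set A|%fset.
  rewrite card_in_imfset//= => x y.
  by rewrite !in_fset_set// !inE; exact: finj.
apply/fsubset_leq_card/fsubsetP => _ /imfsetP[x /= xA ->].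
by move: xA; rewrite !in_fset_set// !inE; exact: fAB.
Qed.

Lemma finite_setI_ball A n : finite_set (A `&` word_ball S n).
Proof. exact/finite_setIr/finite_word_ball. Qed.

Lemma leq_growth A B m n :
  A `&` word_ball S m `<=` B `&` word_ball S n -> (growth S A m <= growth S B n)%N.
Proof.
move=> sAB; apply: (@leq_card_inj _ _ id) => //; exact: finite_setI_ball.
Qed.

Lemma word_ball_le m n : (m <= n)%N -> word_ball S m `<=` word_ball S n.
Proof. by move=> mn x [w [wm wS ->]]; exists w; split=> //; exact: leq_trans mn. Qed.

Lemma word_ball_mul m n x y :
  word_ball S m x -> word_ball S n y -> word_ball S (m + n) (x * y)%g.
Proof.
move=> [v [vm vS ->]] [w [wn wS ->]]; exists (v ++ w); split.
- by rewrite size_cat leq_add.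
- by move=> s; rewrite mem_cat => /orP[/vS|/wS].
- by rewrite big_cat.
Qed.

Lemma word_ball_inv n x : word_ball S n x -> word_ball S n x^-1%g.
Proof.
elim: n x => [|n IHn] x [[|s w] [/= wn wS ->]]; try by exists [::]; rewrite big_nil invg1.
  by [].
rewrite big_cons invgM -addn1; apply: word_ball_mul.
  by apply: IHn; exists w; split=> // t tw; apply: wS; rewrite inE tw orbT.
exists [:: s^-1%g]; split=> //; last by rewrite big_seq1.
by move=> t; rewrite inE => /eqP->; apply: hS.1; apply: wS; rewrite mem_head.
Qed.

Lemma word_ball_cover x : exists n, word_ball S n x.
Proof. by have [w [wS ->]] := hS.2 x; exists (size w), w. Qed.

Lemma growthT n : growth S setT n = #|` fset_set (word_ball S n)|%fset.
Proof. by rewrite /growth setTI. Qed.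

Lemma growth_setU A B n : A `&` B = set0 ->
  growth S (A `|` B) n = (growth S A n + growth S B n)%N.
Proof.
move=> AB; rewrite /growth setIUl fset_setU; try exact: finite_setI_ball.
rewrite -cardfsUI -fset_setI; try exact: finite_setI_ball.
by rewrite setIACA AB set0I fset_set0 cardfs0 addn0.
Qed.

(** Passing from the ball of radius [n] to that of radius [n.+1] adds to [A] at
    most the whole sphere. *)
Lemma growth_step A n :
  (growth S A n.+1 + growth S setT n <= growth S A n + growth S setT n.+1)%N.
Proof.
have nn1 := @word_ball_le n n.+1 (leqnSn n).
have <- : (growth S A n.+1 + growth S (~` A) n.+1 = growth S setT n.+1)%N.
  by rewrite -growth_setU ?setICr// setUv.
have <- : (growth S A n + growth S (~` A) n = growth S setT n)%N.
  by rewrite -growth_setU ?setICr// setUv.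
have : (growth S (~` A) n <= growth S (~` A) n.+1)%N by apply: leq_growth; exact: setIS.
lia.
Qed.

Lemma growth_translate A n s : s \in S ->
  (growth S [set (s * a)%g | a in A] n <= growth S A n.+1)%N.
Proof.
move=> sS; apply: (@leq_card_inj _ _ (fun x => (s^-1 * x)%g)).
- exact: finite_setI_ball.
- exact: finite_setI_ball.
- move=> _ [[a Aa <-] Bsa]; split; first by rewrite mulKg.
  rewrite -add1n; apply: word_ball_mul Bsa; exists [:: s^-1%g]; split=> //.
    by move=> t; rewrite inE => /eqP->; exact: hS.1.
  by rewrite big_seq1.
- by move=> x y _ _; exact: mulgI.
Qed.

(** Along radii at which the ball grows by a factor close to [1], translation by
    a generator changes the proportion of the ball occupied by a set by a
    quantity tending to [0]; the limit of these proportions along an ultrafilter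
    is an invariant mean. Bounding [m] of a translate from above is enough, as
    the inverse translation gives the converse inequality. *)
Lemma subexponential_amenable (R : realType) :
  subexponential R (growth S setT) -> amenable R [set: G].
Proof.
move=> sub; pose b n := growth S setT n.
have B1 n : word_ball S n 1%g by exists [::]; split=> //; rewrite big_nil.
have b_gt0 n : 0 < (b n)%:R :> R.
  rewrite ltr0n /b growthT cardfs_gt0; apply/fset0Pn; exists 1%g.
  by rewrite in_fset_set ?inE//; exact: finite_word_ball.
have /choice[k Hk] j : exists n, (b n.+1)%:R <= (1 + harmonic j) * (b n)%:R :> R.
  apply: subexponential_slow_step sub _ _; first by rewrite -(ltr0n R).
  by rewrite ltrDl invr_gt0.
pose a A j : R := (growth S A (k j))%:R / (b (k j))%:R.
have [U [UU ooU]] := @ultraFilterLemma nat \oo _.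
have a01 A j : 0 <= a A j <= 1.
  rewrite divr_ge0//= ler_pdivrMr// mul1r ler_nat; apply: leq_growth.
  by move=> x [].
have /choice[m Hm] A : exists l : R, a A j @[j --> U] --> l.
  exact: ultra_cvg_bounded.
have hR := @Rhausdorff R.
have m_translate s A : s \in S -> m [set (s * x)%g | x in A] <= m A.
  move=> sS; rewrite -[leRHS]addr0.
  have harm : harmonic j @[j --> U] --> (0 : R).
    by move=> V V0; apply: ooU; exact: cvg_harmonic V0.
  apply: (ler_cvg_to (Hm _) (cvgD (Hm A) harm)); apply: nearW => j.
  suff : a [set (s * x)%g | x in A] j <= a A j + harmonic j by [].
  have -> : harmonic j = harmonic j * (b (k j))%:R / (b (k j))%:R :> R.
    by rewrite mulfK ?gt_eqF.
  rewrite /a -mulrDl ler_pM2r ?invr_gt0//.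
  have := growth_translate A (k j) sS; have := growth_step A (k j).
  rewrite -!(ler_nat R) !natrD -/b; have := Hk j; rewrite mulrDl mul1r /b; lra.
have m_le h A : m [set (h * x)%g | x in A] <= m A.
  have [w [wS ->]] := hS.2 h; elim: w wS A => [|s w IHw] wS A.
    by under eq_imagel do rewrite big_nil mul1g; rewrite image_id.
  under eq_imagel do rewrite big_cons -mulgA.
  rewrite (_ : [set _ | x in A] = 
    [set (s * y)%g | y in [set (\prod_(j <- w) j * x)%g | x in A]]); last first.
    by rewrite -image_comp.
  apply: le_trans (m_translate _ _ _) (IHw _ _); first by apply: wS; rewrite mem_head.
  by move=> t tw; apply: wS; rewrite inE tw orbT.
exists m; split.
- move=> A _; apply: (ler_cvg_to (cvg_cst 0) (Hm A)).
  by apply: nearW => j; case/andP: (a01 A j).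
- apply: (cvg_unique hR (Hm setT)).
  rewrite (_ : a setT = fun=> 1); first exact: cvg_cst.
  by apply/funext => j; rewrite /a divff// gt_eqF.
- move=> A B _ _ AB; apply: (cvg_unique hR (Hm (A `|` B))).
  rewrite (_ : a (A `|` B) = a A \+ a B); first exact: cvgD.
  by apply/funext => j; rewrite /a growth_setU// natrD mulrDl.
- move=> h A _ _; apply/eqP; rewrite eq_le m_le/=.
  have := m_le h^-1%g [set (h * x)%g | x in A].
  rewrite image_comp (_ : _ \o _ = id) ?image_id//.
  by apply/funext => x /=; rewrite mulKg.
Qed.

End WordBalls.

(** * Counting with rapid decay *)

Section RapidDecayCounting.
Variables (R : realType) (G : groupType) (S : {fset G}).
Implicit Types (f : {fsfun G -> R[i] with 0}) (T : {fset G}).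

Lemma operator_norm_le_rho f n (M L : R) : finsupp f != fset0 ->
  [set` finsupp f] `<=` word_ball S n -> (rho R S n <= M%:E)%E ->
  l2norm f = L%:E -> 0 < L ->
  (l2_operator_norm (left_regular_alg f) <= (M * L)%:E)%E.
Proof.
move=> f0 fB rhoM fL L0; rewrite EFinM -lee_pdivrMr//.
apply: le_trans rhoM; apply: ereal_sup_ubound; exists f => //.
by rewrite fL inver gt_eqF.
Qed.

Definition fiber (c : G -> G) T y : {fset G} := [fset t in T | c t == y]%fset.

Lemma sum_fiber (c : G -> G) T (P : pred G) :
  (\sum_(y <- [fset c t | t in T]%fset | P y) #|` fiber c T y|%fset =
   #|` [fset t in T | P (c t)]|%fset)%N.
Proof.
rewrite card_fset_sum1 big_fset/= big_mkcond [RHS]big_mkcond/=.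
rewrite [RHS](partition_big_imfset _ c)/=; apply: eq_bigr => y _.
rewrite card_fset_sum1 big_fset/=; case: ifPn => Py.
  by apply: eq_bigr => t /eqP->; rewrite Py.
by rewrite big1// => t /eqP->; rewrite (negbTE Py).
Qed.

(** The operator norm of the image measure of the counting measure of [T]
    under [c] is at least half its mass on an amenable subgroup, while its
    l2-norm is controlled by the multiplicities of [c]. *)
Lemma rapid_decay_count (H : set G) T (c : G -> G) n (M D : R) :
  amenable R H -> H 1%g -> (forall h k, H h -> H k -> H (h * k)%g) ->
  (forall t, t \in T -> word_ball S n (c t)) ->
  (rho R S n <= M%:E)%E -> 0 <= M ->
  (forall t, t \in T -> (#|` fiber c T (c t)|%fset)%:R <= D) ->
  (#|` [fset t in T | c t \in H]|%fset)%:R ^+ 2 <=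
    4 * M ^+ 2 * (#|` T|%fset)%:R * D.
Proof.
move=> amH H1 HM cB rhoM M0 multD.
have [->|/fset0Pn[t0 t0T]] := eqVneq T fset0.
  rewrite (_ : [fset t in fset0 | _]%fset = fset0); last first.
    by apply/fsetP => t; rewrite !inE.
  by rewrite cardfs0 expr0n/= mulr0 mul0r.
pose E := [fset c t | t in T]%fset; pose N y := #|` fiber c T y|%fset.
have N_gt0 y : (0 < N y)%N = (y \in E).
  rewrite cardfs_gt0; apply/fset0Pn/imfsetP.
    by move=> [t]; rewrite !inE/= => /andP[tT /eqP<-]; exists t.
  by move=> [t tT ->]; exists t; rewrite !inE/= tT eqxx.
have [f fN] : exists f, forall y, f y = real_complex R (N y)%:R.
  exists [fsfun y in E => real_complex R (N y)%:R] => y; rewrite fsfunE.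
  by case: ifPn => //; rewrite -N_gt0 -leqNgt leqn0 => /eqP->; rewrite rmorph0.
have supp_f : finsupp f = E.
  apply/fsetP => y; rewrite mem_finsupp fN -N_gt0 fmorph_eq0 pnatr_eq0.
  by rewrite lt0n.
have sumN : \sum_(y <- E) (N y)%:R = (#|` T|%fset)%:R :> R.
  rewrite -natr_sum sum_fiber; congr (#|` _|%fset)%:R.
  by apply/fsetP => t; rewrite !inE/= andbT.
pose L2 : R := \sum_(y <- E) (N y)%:R ^+ 2.
have L2_gt0 : 0 < L2.
  rewrite /L2 (big_fsetD1 (c t0))/=; last by apply/imfsetP; exists t0.
  rewrite ltr_pwDl ?exprn_gt0 ?ltr0n ?N_gt0//; first by apply/imfsetP; exists t0.
  by apply: sumr_ge0 => y _; exact: sqr_ge0.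
have L2_le : L2 <= (#|` T|%fset)%:R * D.
  rewrite -sumN mulr_suml /L2 big_seq [leRHS]big_seq; apply: ler_sum => y yE.
  by rewrite expr2 ler_wpM2l//; have /imfsetP[t tT ->] := yE; exact: multD.
have norm_f : l2norm f = (Num.sqrt L2)%:E.
  rewrite (@l2norm_finite_support _ _ _ E).
    by congr (Num.sqrt _)%:E; apply: eq_bigr => y _; rewrite fN normc_real.
  by move=> y; rewrite -supp_f => /fsfun_dflt.
have := amenable_mass_le_norm amH H1 HM (fun y => ler0n R (N y)) fN.
have /(operator_norm_le_rho (n := n))/(_ _ rhoM norm_f) : finsupp f != fset0.
  by rewrite supp_f; apply/fset0Pn; exists (c t0); apply/imfsetP; exists t0.
rewrite supp_f sqrtr_gt0 => /(_ _ L2_gt0) opn /le_trans/(_ (opn _)).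
rewrite lee_fin -natr_sum sum_fiber => mass.
have {mass} : (#|` [fset t in T | c t \in H]|%fset)%:R <= 2 * M * Num.sqrt L2.
  by rewrite -mulrA -ler_pdivrMl// mulrC; apply: mass => _ /imfsetP[t tT ->]; exact: cB.
move=> mass; apply: (@le_trans _ _ ((2 * M * Num.sqrt L2) ^+ 2)).
  by rewrite lerXn2r// nnegrE// !mulr_ge0// sqrtr_ge0.
rewrite !exprMn (sqr_sqrtr (ltW L2_gt0)).
have /ler_wpM2l/(_ _ _ L2_le) : 0 <= 4 * M ^+ 2 by rewrite mulr_ge0// sqr_ge0.
lra.
Qed.

End RapidDecayCounting.

(** * Covering a compact space by translates of a fixed open set *)

Lemma uniform_bound d (T : orderType d) (x0 : T) (I : eqType) (r : seq I)
    (P : I -> T -> Prop) :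
  (forall i x y, (x <= y)%O -> P i x -> P i y) ->
  (forall i, i \in r -> exists x, P i x) ->
  exists x, forall i, i \in r -> P i x.
Proof.
move=> monoP; elim: r => [_|i r IHr exP]; first by exists x0.
have [x Px] := exP i (mem_head _ _).
have [|y Py] := IHr; first by move=> j jr; apply: exP; rewrite inE jr orbT.
exists (Order.max x y) => j; rewrite inE => /orP[/eqP->|/Py].
  by apply: monoP Px; rewrite le_max lexx.
by apply: monoP; rewrite le_max lexx orbT.
Qed.

Lemma card_le_cover (R : realType) (I : eqType) (T : choiceType) (r : seq I)
    (A : {fset T}) (P : I -> pred T) (b : R) :
  (forall t, t \in A -> has (P^~ t) r) ->
  (forall i, i \in r -> (#|` [fset t in A | P i t]|%fset)%:R <= b) ->
  (#|` A|%fset)%:R <= (size r)%:R * b.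
Proof.
move=> covA Pb.
have : (#|` A| <= \sum_(i <- r) #|` [fset t in A | P i t]|)%fset%N.
  under eq_bigr do rewrite card_fset_sum1 big_fset/= big_mkcond/=.
  rewrite exchange_big/= card_fset_sum1 big_seq [leqRHS]big_seq.
  apply: leq_sum => t /covA; rewrite has_count -sum1_count big_mkcond/=.
  by move=> /leq_trans; apply; apply: leq_sum => i _; case: ifP.
rewrite -(ler_nat R) natr_sum => /le_trans; apply.
rewrite mulr_natl -[leRHS]addr0 -iter_addr -[size r]count_predT -big_const_seq.
by rewrite big_seq [leRHS]big_seq; exact: ler_sum.
Qed.

Section Dynamics.
Variables (R : realType) (G : groupType) (S : {fset G}).
Hypothesis hS : symmetric_generating_set S.
Variables (X : topologicalType) (act : G -> X -> X).
Hypothesis hX : compact_Gspace act.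

Let act1 x : act 1%g x = x. Proof. by case: hX. Qed.
Let actM g h x : act (g * h)%g x = act g (act h x). Proof. by case: hX. Qed.
Let actK g x : act g (act g^-1%g x) = x. Proof. by rewrite -actM mulgV. Qed.

Lemma neighborhood_stabilizer1 x : neighborhood_stabilizer act x 1%g.
Proof. by exists setT; split=> //; split=> //; exact: openT. Qed.

Lemma neighborhood_stabilizerM x h k : neighborhood_stabilizer act x h ->
  neighborhood_stabilizer act x k -> neighborhood_stabilizer act x (h * k)%g.
Proof.
move=> [U [[oU Ux] hU]] [V [[oV Vx] kV]]; exists (U `&` V); split.
  by split; [exact: openI|split].
by move=> y [Uy Vy]; rewrite actM kV// hU.
Qed.

Lemma open_act_preimage h (U : set X) : open U -> open (act h @^-1` U).
Proof. by move=> oU; apply: open_comp => // x _; case: hX => _ _ _ _; apply. Qed.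

(** On a neighborhood of [x], [h^-1] takes values in [U], where [g] is the
    identity. *)
Lemma neighborhood_stabilizer_conj (g h : G) (U : set X) x : open U ->
  U `<=` fixed_points act g -> U (act h^-1%g x) ->
  neighborhood_stabilizer act x (h * g * h^-1)%g.
Proof.
move=> oU Ufix Ux; exists (act h^-1%g @^-1` U); split.
  by split=> //; exact: open_act_preimage.
by move=> y Uy; rewrite !actM (Ufix _ Uy) actK.
Qed.

Lemma finite_translate_cover (P : set G) (U : set X) : open U ->
  (forall x, exists2 s, P s & U (act s^-1%g x)) ->
  exists r : seq G, (forall s, s \in r -> P s) /\
    forall x, exists2 s, s \in r & U (act s^-1%g x).
Proof.
move=> oU cov; have [[x0]|noX] := pselect (exists x : X, True); last first.
  by exists [::]; split=> // x; case: noX; exists x.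
pose pX : ptopologicalType := HB.pack (Topological.sort X) (isPointed.Build X x0).
have cX : @compact pX [set: X] by case: hX.
rewrite compact_cover in cX.
have [|x _|r rP rcov] := cX G P (fun s => act s^-1%g @^-1` U).
- by move=> s _; exact: open_act_preimage.
- by have [s Ps Us] := cov x; exists s.
- exists r; split=> [s /rP/set_mem//|x].
  by have [s sr Us] := rcov x I; exists s.
Qed.

Lemma conjugate_centralizer (g s u : G) :
  commute u (s * g * s^-1)%g -> conjugate s (centralizer g) u.
Proof.
move=> comm; exists (s^-1 * u * s)%g; last by rewrite !mulgA mulgV mul1g mulgK.
rewrite /centralizer/= /commute.
have -> : (s^-1 * u * s * g = s^-1 * (u * (s * g * s^-1)) * s)%g.
  by rewrite !mulgA mulgVK.
by rewrite comm !mulgA mulVg mul1g.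
Qed.

(** For [T] the part of [A] in the ball of radius [n], each [t] in [T] conjugates
    [s * g * s^-1] into the neighborhood stabilizer of [x0] for one of the
    finitely many [s]. Counting these [t] with [rapid_decay_count] bounds [#|T|] by
    a subexponential factor times the square root of [#|T|]. *)
Lemma covering_growth (g : G) (A : set G) (U : set X) (r : seq G) (x0 : X) :
  sub_rapid_decay R S -> amenable_neighborhood_stabilizers act R ->
  (forall a b, A a -> A b -> A (a^-1 * b)%g) ->
  open U -> U `<=` fixed_points act g ->
  (forall x, exists2 s, s \in r & U (act s^-1%g x)) ->
  (forall s, s \in r -> subexponential R
     (growth S (A `&` conjugate s (centralizer g)))) ->
  subexponential R (growth S A).
Proof.
move=> hSRD hstab AV oU Ufix cov subD p p1.
(* #|T| is bounded by a constant times q ^ (2 * n) squared, from the operator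
   norm, times q ^ (2 * n), from the multiplicities: the base is q ^ 6 *)
have [q q1 qp] := root_gt1 5 p1.
have q0 : 0 < q by rewrite (lt_trans _ q1).
have [N rhoN] := grows_subexponentially_le hSRD q1.
have [c Hc] : exists c, forall s, s \in r -> word_ball S c (s * g * s^-1)%g.
  apply: (uniform_bound 0%N) => [s x y xy|s _]; first by apply: word_ball_le.
  exact: word_ball_cover.
have [d Hd] : exists d : R, forall s, s \in r -> forall n,
    (growth S (A `&` conjugate s (centralizer g)) n)%:R <= d * q ^+ n.
  apply: (uniform_bound (0 : R)) => [s x y xy Hx n|s sr]; last exact: subD.
  by rewrite (le_trans (Hx n))// ler_wpM2r// exprn_ge0// ltW.
(* the summand N makes the bound on rho available for all n *)
pose k : R := (size r)%:R; pose M n : R := q ^+ (N + c + n.*2).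
exists (4 * k ^+ 2 * q ^+ (N + c) ^+ 2 * d) => n.
pose T := fset_set (A `&` word_ball S n).
have finT := @finite_setI_ball _ S A n.
have TP t : t \in T -> A t /\ word_ball S n t by rewrite in_fset_set// inE.
pose H := neighborhood_stabilizer act x0.
pose y s t : G := (t * (s * g * s^-1) * t^-1)%g.
pose D : R := d * q ^+ n.*2.
have M0 : 0 <= M n by rewrite exprn_ge0// ltW.
have fiberD s t : s \in r -> t \in T -> (#|` fiber (y s) T (y s t)|%fset)%:R <= D.
  move=> sr tT; apply: le_trans (Hd s sr _); rewrite ler_nat.
  have [At Bt] := TP _ tT.
  rewrite -[X in (size (enum_fset X) <= _)%N]set_fsetK.
  apply: (@leq_card_inj _ _ _ (fun t' => (t^-1 * t')%g)).
  - exact: finite_fset.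
  - exact: finite_setI_ball.
  - move=> t'; rewrite /= !inE/= => /andP[/TP[At' Bt'] /eqP yt].
    split; last by rewrite -addnn; apply: word_ball_mul => //; exact: word_ball_inv.
    split; first exact: AV.
    apply: conjugate_centralizer; rewrite /commute.
    move: yt; rewrite /y => /(congr1 (fun z => t^-1 * z * t')%g).
    by rewrite !mulgA mulgVK mulVg mul1g.
  - by move=> u v _ _; exact: mulgI.
have count s : s \in r ->
    (#|` [fset t in T | y s t \in H]|%fset)%:R <=
    Num.sqrt (4 * M n ^+ 2 * (#|` T|%fset)%:R * D).
  move=> sr; rewrite -[leLHS]ger0_norm// -sqrtr_sqr ler_wsqrtr//.
  apply: (@rapid_decay_count _ _ S _ _ _ (N + c + n.*2)) => //.
  - exact: hstab.
  - exact: neighborhood_stabilizer1.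
  - exact: neighborhood_stabilizerM.
  - move=> t /TP[_ Bt]; apply: (@word_ball_le _ _ (n + c + n)); first lia.
    apply: word_ball_mul; last exact: word_ball_inv.
    by apply: word_ball_mul => //; exact: Hc.
  - by apply: rhoN; rewrite -addnA leq_addr.
  - by move=> t tT; exact: fiberD.
have := card_le_cover (r := r) (A := T) (P := fun s t => y s t \in H) _ count.
have cT : forall t, t \in T -> has (fun s => y s t \in H) r.
  move=> t _; have [s sr Us] := cov (act t^-1%g x0); apply/hasP; exists s => //.
  rewrite inE /H (_ : y s t = (t * s) * g * (t * s)^-1)%g.
    by apply: neighborhood_stabilizer_conj oU Ufix _; rewrite invgM actM.
  by rewrite /y invgM !mulgA.
move=> /(_ cT) Tle; rewrite -/(growth S A n) in Tle.
have D0 : #|` T|%fset != 0%N -> 0 <= D.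
  rewrite -lt0n cardfs_gt0 => /fset0Pn[t tT].
  by have [s sr _] := cov x0; exact: le_trans (fiberD s t sr tT).
have [T0|T_neq0] := eqVneq #|` T|%fset 0%N.
  have d0 : 0 <= d.
    have [s sr _] := cov x0; have := Hd s sr 0%N; rewrite expr0 mulr1.
    by move=> /(le_trans (ler0n _ _)).
  rewrite /growth -/T T0 mulr_ge0//; last by rewrite exprn_ge0// ltW// (lt_trans _ p1).
  by rewrite !mulr_ge0// exprn_ge0// ltW.
have {}D0 := D0 T_neq0.
have T_gt0 : 0 < (#|` T|%fset)%:R :> R by rewrite ltr0n lt0n.
have : (#|` T|%fset)%:R ^+ 2 <= k ^+ 2 * (4 * M n ^+ 2 * (#|` T|%fset)%:R * D).
  have B0 : 0 <= 4 * M n ^+ 2 * (#|` T|%fset)%:R * D.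
    by apply: mulr_ge0 => //; apply: mulr_ge0 => //; apply: mulr_ge0 => //; exact: sqr_ge0.
  rewrite -(sqr_sqrtr B0) -exprMn lerXn2r// nnegrE ?mulr_ge0 ?sqrtr_ge0//.
rewrite expr2 (_ : k ^+ 2 * _ = 4 * k ^+ 2 * M n ^+ 2 * D * (#|` T|%fset)%:R); last by ring.
rewrite ler_pM2r// => /le_trans; apply.
have -> : M n = q ^+ (N + c) * (q ^+ n) ^+ 2 by rewrite /M exprD -muln2 exprM.
have -> : D = d * (q ^+ n) ^+ 2 by rewrite /D -muln2 exprM.
have -> : p ^+ n = (q ^+ n) ^+ 6 by rewrite -qp -!exprM mulnC.
by rewrite le_eqVlt; apply/orP; left; apply/eqP; ring.
Qed.

End Dynamics.

(** * Topological freeness *)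

Lemma centralizerV (G : groupType) (g a : G) :
  centralizer g a -> centralizer g a^-1%g.
Proof. by rewrite /centralizer/= => /commute_sym/commuteV/commute_sym. Qed.

Lemma centralizerVM (G : groupType) (g a b : G) :
  centralizer g a -> centralizer g b -> centralizer g (a^-1 * b)%g.
Proof.
move=> /centralizerV/commute_sym ag /commute_sym bg; apply/commute_sym.
exact: commuteM.
Qed.

Lemma subexponential_shift (R : realType) (phi psi : nat -> nat) k :
  subexponential R psi -> (forall n, (phi n <= psi (n + k))%N) ->
  subexponential R phi.
Proof.
move=> sub le_phi r r1; have [c Hc] := sub r r1.
exists (c * r ^+ k) => n; rewrite -mulrA -exprD addnC.
by apply: le_trans (Hc _); rewrite ler_nat.
Qed.

Lemma growth_conjugate (G : groupType) (S : {fset G}) (A : set G) s k n :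
  symmetric_generating_set S -> word_ball S k s ->
  (growth S (conjugate s A) n <= growth S A (n + k.*2))%N.
Proof.
move=> hS Bs; apply: (@leq_card_inj _ _ _ (fun x => (s^-1 * (x * s))%g)).
- exact: finite_setI_ball.
- exact: finite_setI_ball.
- move=> _ [[a Aa <-] Bx]; split; first by rewrite !mulgA mulVg mul1g mulgVK.
  rewrite -addnn addnCA; apply: word_ball_mul; first exact: word_ball_inv.
  exact: word_ball_mul.
- by move=> x y _ _ /mulgI/mulIg.
Qed.

(** Two elements of the same left coset of [C] and of the same left coset of
    [gamma * C * gamma^-1] differ by an element of the intersection of these
    subgroups, so that finite index passes to the intersection. *)
Lemma finite_index_growth (R : realType) (G : groupType) (S : {fset G})
    (g gamma : G) (r : seq G) :
  symmetric_generating_set S ->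
  (forall t, exists2 s, s \in r & centralizer g (s^-1 * t)%g) ->
  subexponential R
    (growth S (centralizer g `&` conjugate gamma (centralizer g))) ->
  subexponential R (growth S setT).
Proof.
move=> hS cosets subD p p1; have [q q1 qp] := root_gt1 1 p1.
have [d Hd] := subD q q1.
exists ((size (allpairs pair r r))%:R * d) => n.
rewrite -mulrA; pose T := fset_set ([set: G] `&` word_ball S n).
have finT := @finite_setI_ball _ S setT n.
(* left cosets of C and of gamma * C * gamma^-1, in terms of t and t * gamma *)
pose P (ij : G * G) t := (t \in [set t | centralizer g (ij.1^-1 * t)%g /\
  centralizer g (ij.2^-1 * (t * gamma))%g]).
apply: (@card_le_cover R _ _ _ T P) => [t _|[i j] _].
  have [i ir it] := cosets t; have [j jr jt] := cosets (t * gamma)%g.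
  apply/hasP; exists (i, j); first by apply/allpairsP; exists (i, j).
  by rewrite /P inE.
have [->|/fset0Pn[t0]] := eqVneq [fset t in T | P (i, j) t]%fset fset0.
  rewrite cardfs0 -qp -exprM; apply: le_trans (Hd _); exact: ler0n.
rewrite !inE/= /P => /andP[]; rewrite in_fset_set// !inE => -[_ B0] [/= it0 jt0].
apply: le_trans (_ : d * q ^+ (n + n) <= _); last first.
  by rewrite -qp -exprM mul2n addnn.
apply: le_trans (Hd _); rewrite ler_nat.
rewrite -[X in (size (enum_fset X) <= _)%N]set_fsetK.
apply: (@leq_card_inj _ _ _ (fun t => (t0^-1 * t)%g)).
- exact: finite_fset.
- exact: finite_setI_ball.
- move=> t; rewrite /= !inE/= => /andP[]; rewrite in_fset_set// !inE => -[_ Bt] [/= it jt].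
  split; last by apply: word_ball_mul => //; exact: word_ball_inv.
  split; first by have := centralizerVM it0 it; rewrite invgM invgK -mulgA mulVKg.
  exists (gamma^-1 * (t0^-1 * t) * gamma)%g.
    by have := centralizerVM jt0 jt; rewrite !invgM invgK !mulgA mulgK.
  by rewrite !mulgA mulgV mul1g mulgK.
- by move=> x y _ _; exact: mulgI.
Qed.

Theorem corollary2 (R : realType) (Gamma : groupType) (S : {fset Gamma})
    (hS : symmetric_generating_set S)
    (hnonamenable : ~ amenable R [set: Gamma])
    (hSRD : sub_rapid_decay R S)
    (g : Gamma)
    (hg : ~ (forall h : Gamma, commute g h))
    (hC : forall gamma : Gamma, ~ centralizer g gamma ->
       subset_grows_subexponentially R S
         (centralizer g `&` conjugate gamma (centralizer g)))
    (X : topologicalType) (act : Gamma -> X -> X)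
    (hX : compact_Gspace act)
    (hmin : minimal_Gspace act)
    (hstab : amenable_neighborhood_stabilizers act R) :
  acts_topologically_freely act g.
Proof.
set C := centralizer g; pose U := interior (fixed_points act g).
have oU : open U by exact: open_interior.
have Ufix : U `<=` fixed_points act g by exact: interior_subset.
apply: contrapT => /eqP/set0P[x0 Ux0]; apply: hnonamenable.
have {}hC gamma : ~ C gamma ->
    subexponential R (growth S (C `&` conjugate gamma C)).
  by move=> /hC/subexponential_of_grows.
apply: (subexponential_amenable hS).
have [cov|/existsNP[z noz]] := pselect (forall x, exists2 s, ~ C s & U (act s^-1%g x)).
  have [r [rC rcov]] := finite_translate_cover hX oU cov.
  have subC : subexponential R (growth S C).
    apply: (covering_growth hS hX x0 hSRD hstab _ oU Ufix rcov) => [a b|s /rC].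
      exact: centralizerVM.
    exact: hC.
  apply: (covering_growth hS hX x0 hSRD hstab _ oU Ufix rcov) => // s _.
  have [k Bs] := word_ball_cover hS s; rewrite setTI.
  by apply: (subexponential_shift subC) => n; exact: growth_conjugate Bs.
(* the times at which z visits U form a syndetic set, hence C has finite index *)
have visits t : U (act t z) -> C t.
  move=> Ut; apply: contrapT => Ct; apply: noz; exists t^-1%g; rewrite ?invgK//.
  by move=> /centralizerV; rewrite invgK.
have [r [_ rcov]] : exists r : seq Gamma, (forall s, s \in r -> [set: Gamma] s) /\
    forall x, exists2 s, s \in r & U (act s^-1%g x).
  apply: (finite_translate_cover hX oU) => x.
  have [y [Uy [h _ hy]]] := hmin x U (ex_intro _ x0 Ux0) oU.
  by exists h^-1%g; rewrite // invgK hy.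
have [gamma Cgamma] : exists gamma, ~ C gamma.
  apply: contrapT => allC; apply: hg => h; apply/commute_sym.
  by apply: contrapT => ch; apply: allC; exists h.
apply: (finite_index_growth (g := g) (gamma := gamma) (r := r) hS _ (hC _ Cgamma)) => t.
have [_ _ _ actM _] := hX; have [s sr Us] := rcov (act t z).
by exists s => //; apply: visits; rewrite actM.
Qed.
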